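(* Let $\varepsilon\in(0,1)$, $m,n\in\mathbb{Z}_{>0}$, $\boldsymbol{u}\in\mathbb{R}_{>0}^m$, $\boldsymbol{v}\in\mathbb{R}_{>0}^n$ with $\|\boldsymbol{u}\|_1=\|\boldsymbol{v}\|_1=1$, and $B\in\mathbb{R}_{\ge0}^{m\times n}$ nonzero. For an integer $t\ge0$ and $L\in\mathbb{Z}_{>0}$ with $R(\boldsymbol{u},\boldsymbol{v},L)\ge2$, let $A'$ be the SK iterate at step $t$ with input $(B,(\boldsymbol{u},\boldsymbol{v}))$ and let $A$ be the SK iterate at step $t$ with input $(G(B,f_1(\boldsymbol{u},\boldsymbol{v},L),f_2(\boldsymbol{u},\boldsymbol{v},L)),(\boldsymbol{1},\boldsymbol{1}))$. Then for every fixed $t\ge0$ there is an integer $\ell$ (depending on $t$ and $\varepsilon$) such that for all $L\ge\ell$, $$\Bigl|\|\boldsymbol{r}(A')-\boldsymbol{u}\|_1+\|\boldsymbol{c}(A')-\boldsymbol{v}\|_1-\tfrac{1}{L}\bigl(\|\boldsymbol{r}(A)-\boldsymbol{1}\|_1+\|\boldsymbol{c}(A)-\boldsymbol{1}\|_1\bigr)\Bigr|\le\varepsilon.$$ Moreover, if $L>0$ is such that $L\boldsymbol{u}$ and $L\boldsymbol{v}$ are integer vectors, then for every integer $t\ge0$, $$\|\boldsymbol{r}(A')-\boldsymbol{u}\|_1+\|\boldsymbol{c}(A')-\boldsymbol{v}\|_1=\tfrac{1}{L}\bigl(\|\boldsymbol{r}(A)-\boldsymbol{1}\|_1+\|\b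oldsymbol{c}(A)-\boldsymbol{1}\|_1\bigr).$$
   Context: SK on input $(A,(\boldsymbol{u},\boldsymbol{v}))$: $A^{(0)}_{ij}=u_iA_{ij}/r_i(A)$; odd $k$: $A^{(k)}_{ij}=v_jA^{(k-1)}_{ij}/c_j(A^{(k-1)})$; even $k\ge2$: $A^{(k)}_{ij}=u_iA^{(k-1)}_{ij}/r_i(A^{(k-1)})$; ''step $t$'' iterate is $A^{(t)}$; $r_i,c_j$ are row/column sums, $\boldsymbol{r},\boldsymbol{c}$ their vectors, $\boldsymbol{1}$ the all-ones vector. Discretization: for $L\in\mathbb{Z}_{>0}$ put $s=\sum_i\lfloor Lu_i\rfloor-\sum_j\lfloor Lv_j\rfloor$. If $s\ge0$: $f_1(\boldsymbol{u},\boldsymbol{v},L)=(\lfloor Lu_1\rfloor,\dots,\lfloor Lu_m\rfloor)$ and $f_2(\boldsymbol{u},\boldsymbol{v},L)=(\lfloor Lv_1\rfloor+1,\dots,\lfloor Lv_s\rfloor+1,\lfloor Lv_{s+1}\rfloor,\dots,\lfloor Lv_n\rfloor)$. If $s<0$: $f_1=(\lfloor Lu_1\rfloor+1,\dots,\lfloor Lu_{-s}\rfloor+1,\lfloor Lu_{-s+1}\rfloor,\dots,\lfloor Lu_m\rfloor)$, $f_2=(\lfloor Lv_1\rfloor,\dots,\lfloor Lv_n\rfloor)$. Then $\|f_1\|_1=\|f_2\|_1$. $R(\boldsymbol{u},\boldsymbol{v},L)=\min\{\min_i\lfloor Lu_i\rfloor,\min_j\lfloor Lv_j\rfloor\}$.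 Splitting: for positive integer vectors $\boldsymbol{a}\in\mathbb{Z}_{>0}^m,\boldsymbol{b}\in\mathbb{Z}_{>0}^n$ with $\|\boldsymbol{a}\|_1=\|\boldsymbol{b}\|_1$ and $A\in\mathbb{R}_{\ge0}^{m\times n}$, let $S_i=\{\sum_{k<i}a_k+1,\dots,\sum_{k\le i}a_k\}$, $T_j=\{\sum_{k<j}b_k+1,\dots,\sum_{k\le j}b_k\}$; $G(A,\boldsymbol{a},\boldsymbol{b})$ is the $\|\boldsymbol{a}\|_1\times\|\boldsymbol{b}\|_1$ matrix with entries $A_{ij}/(a_ib_j)$ at all positions $(i',j')\in S_i\times T_j$. *)

(* Defs.v *)
From HB Require Import structures.
From mathcomp Require Import all_boot all_order all_algebra.
From mathcomp Require Import reals.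

Set Implicit Arguments.
Unset Strict Implicit.
Unset Printing Implicit Defensive.

Import Order.TTheory GRing.Theory Num.Theory.

Local Open Scope ring_scope.

Definition norm1 (R : realType) (k : nat) (x : 'rV[R]_k) : R :=
  \sum_(i < k) `|x 0 i|.

Definition row_sums (R : realType) (m n : nat) (A : 'M[R]_(m, n)) : 'rV[R]_m :=
  \row_i \sum_(j < n) A i j.

Definition col_sums (R : realType) (m n : nat) (A : 'M[R]_(m, n)) : 'rV[R]_n :=
  \row_j \sum_(i < m) A i j.

(* Since x / 0 = 0, a zero row (resp. column) of a nonnegative matrix is left
   unchanged by the two normalizations below. *)
Definition normalize_rows (R : realType) (m n : nat) (u : 'rV[R]_m)
    (A : 'M[R]_(m, n)) : 'M[R]_(m, n) :=
  \matrix_(i, j) (u 0 i * A i j / row_sums A 0 i).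

Definition normalize_cols (R : realType) (m n : nat) (v : 'rV[R]_n)
    (A : 'M[R]_(m, n)) : 'M[R]_(m, n) :=
  \matrix_(i, j) (v 0 j * A i j / col_sums A 0 j).

Fixpoint SK (R : realType) (m n : nat) (A : 'M[R]_(m, n)) (u : 'rV[R]_m)
    (v : 'rV[R]_n) (t : nat) : 'M[R]_(m, n) :=
  match t with
  | 0%N => normalize_rows u A
  | k.+1 => if odd k.+1 then normalize_cols v (SK A u v k)
            else normalize_rows u (SK A u v k)
  end.

(* [Num.truncn] is the floor, as a natural number, of a nonnegative real. *)
Definition floor_scale (R : realType) (k : nat) (L : nat) (x : 'rV[R]_k)
    (i : 'I_k) : nat :=
  Num.truncn (L%:R * x 0 i).

Definition floor_excess (R : realType) (m n : nat) (u : 'rV[R]_m)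
    (v : 'rV[R]_n) (L : nat) : int :=
  (\sum_(i < m) floor_scale L u i)%N%:Z - (\sum_(j < n) floor_scale L v j)%N%:Z.

(* Indices start at 0, so the first |s| coordinates are those with i < |s|;
   the boolean i < |s| is coerced to 0 or 1. *)
Definition f1 (R : realType) (m n : nat) (u : 'rV[R]_m) (v : 'rV[R]_n)
    (L : nat) (i : 'I_m) : nat :=
  let s := floor_excess u v L in
  if 0 <= s then floor_scale L u i
  else (floor_scale L u i + (i < `|s|)%N)%N.

Definition f2 (R : realType) (m n : nat) (u : 'rV[R]_m) (v : 'rV[R]_n)
    (L : nat) (j : 'I_n) : nat :=
  let s := floor_excess u v L in
  if 0 <= s then (floor_scale L v j + (j < `|s|)%N)%N
  else floor_scale L v j.

(* When the entries of u and v lie in [0, 1] all the floors are at most L, so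
   the default value L does not affect the minima. *)
Definition min_floor (R : realType) (m n : nat) (u : 'rV[R]_m) (v : 'rV[R]_n)
    (L : nat) : nat :=
  minn (\big[minn/L]_(i < m) floor_scale L u i)
       (\big[minn/L]_(j < n) floor_scale L v j).

Definition split_mx (R : realType) (m n : nat) (A : 'M[R]_(m, n))
    (a : 'I_m -> nat) (b : 'I_n -> nat) :
    'M[R]_(\sum_(i < m) a i, \sum_(j < n) b j) :=
  \mxblock_(i < m, j < n) (const_mx (A i j / (a i * b j)%:R) : 'M[R]_(a i, b j)).

(* Main.v *)
(** Spreading an m x n matrix X over the blocks of sizes a_i x b_j, each entry
    of the block (i, j) being X_ij / (a_i b_j), divides the i-th row sum by a_i
    and repeats it a_i times. Hence SK on the split matrix with all-one targets
    is the splitting of SK on B with targets (a, b), and its l1-error is the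
    error of the latter. By homogeneity, dividing everything by L turns the
    targets into (a/L, b/L). When L u and L v are integral these are (u, v)
    themselves; in general they tend to (u, v), and for fixed t the iterate is a
    continuous function of its positive targets, because the zero pattern of
    the iterates is that of B. *)
Require Import Defs.
From HB Require Import structures.
From mathcomp Require Import all_boot all_order all_algebra.
From mathcomp Require Import reals.
From mathcomp Require Import boolp classical_sets topology normedtype lra.

Set Implicit Arguments.
Unset Strict Implicit.
Unset Printing Implicit Defensive.

Import Order.TTheory GRing.Theory Num.Theory.
Import numFieldNormedType.Exports.

Local Open Scope ring_scope.

Section SinkhornKnopp.
Variable R : realType.

(** * Transposition and homogeneity *)

(** Transposing reduces each column step to a row step, so the facts below are mostly proved for
    rows only. *)
Lemma normalize_colsE m n (v : 'rV[R]_n) (A : 'M[R]_(m, n)) :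
  normalize_cols v A = (normalize_rows v A^T)^T.
Proof.
apply/matrixP => i j; rewrite !mxE; congr (_ / _).
by apply: eq_bigr => k _; rewrite mxE.
Qed.

Lemma col_sumsE m n (A : 'M[R]_(m, n)) : col_sums A = row_sums A^T.
Proof. by apply/rowP => j; rewrite !mxE; apply: eq_bigr => i _; rewrite mxE. Qed.

Lemma SKS m n (A : 'M[R]_(m, n)) u v t :
  SK A u v t.+1 = if odd t then normalize_rows u (SK A u v t)
                  else normalize_cols v (SK A u v t).
Proof. by rewrite /=; case: odd. Qed.

Lemma row_sumsZ m n (c : R) (A : 'M[R]_(m, n)) :
  row_sums (c *: A) = c *: row_sums A.
Proof.
by apply/rowP => i; rewrite !mxE big_distrr; apply: eq_bigr => j _; rewrite mxE.
Qed.

Lemma norm1Z k (c : R) (x : 'rV[R]_k) : norm1 (c *: x) = `|c| * norm1 x.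
Proof.
by rewrite /norm1 big_distrr; apply: eq_bigr => i _; rewrite mxE normrM.
Qed.

Lemma normalize_rowsZl m n (c : R) (u : 'rV_m) (A : 'M[R]_(m, n)) :
  normalize_rows (c *: u) A = c *: normalize_rows u A.
Proof. by apply/matrixP => i j; rewrite !mxE !mulrA. Qed.

Lemma normalize_rowsZr m n (c : R) u (A : 'M[R]_(m, n)) :
  c != 0 -> normalize_rows u (c *: A) = normalize_rows u A.
Proof.
move=> c0; apply/matrixP => i j; rewrite [LHS]mxE row_sumsZ !mxE.
by rewrite mulrCA -mulf_div divff // mul1r.
Qed.

(** A normalization is linear in its target and of degree 0 in the matrix, so the factor $c$ enters
    each iterate exactly once. *)
Lemma SKZ m n (c : R) (B : 'M[R]_(m, n)) (u : 'rV_m) (v : 'rV_n) t :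
  c != 0 -> SK B (c *: u) (c *: v) t = c *: SK B u v t.
Proof.
move=> c0; elim: t => [|t IH]; first exact: normalize_rowsZl.
rewrite !SKS IH !normalize_colsE linearZ /= !normalize_rowsZr //.
by rewrite !normalize_rowsZl linearZ; case: odd.
Qed.

(** * Splitting commutes with the iteration *)

(** An index of the split matrix is a block [tagnat.sig1 s] with a position inside it; a term
    depending only on block $i$ occurs $a_i$ times. *)
Lemma sum_sig1 k (a : 'I_k -> nat) (F : 'I_k -> R) :
  \sum_(s < \sum_(i < k) a i) F (tagnat.sig1 s) = \sum_(i < k) (a i)%:R * F i.
Proof.
transitivity (\sum_(i < k) \sum_(j < a i) F i); last first.
  by apply: eq_bigr => i _; rewrite sumr_const card_ord mulr_natl.
by rewrite sig_big_dep /= (reindex _ tagnat.sig_bij_on).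
Qed.

Lemma split_mxE m n (A : 'M[R]_(m, n)) (a : 'I_m -> nat) (b : 'I_n -> nat) s t :
  split_mx A a b s t =
  A (tagnat.sig1 s) (tagnat.sig1 t)
    / ((a (tagnat.sig1 s))%:R * (b (tagnat.sig1 t))%:R).
Proof. by rewrite !mxE natrM. Qed.

Lemma split_mx_tr m n (A : 'M[R]_(m, n)) (a : 'I_m -> nat) (b : 'I_n -> nat) :
  (split_mx A a b)^T = split_mx A^T b a.
Proof.
by apply/matrixP => s t; rewrite mxE !split_mxE mxE [_%:R * _]mulrC.
Qed.

Definition natrow k (a : 'I_k -> nat) : 'rV[R]_k := \row_i (a i)%:R.

Lemma row_sums_split m n (A : 'M[R]_(m, n)) (a : 'I_m -> nat) (b : 'I_n -> nat)
    s : (forall j, 0 < b j)%N ->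
  row_sums (split_mx A a b) 0 s =
  row_sums A 0 (tagnat.sig1 s) / (a (tagnat.sig1 s))%:R.
Proof.
move=> b0; rewrite !mxE; under eq_bigr do rewrite split_mxE.
rewrite (sum_sig1 b
  (fun j => A (tagnat.sig1 s) j / ((a (tagnat.sig1 s))%:R * (b j)%:R))).
rewrite big_distrl; apply: eq_bigr => j _ /=.
by rewrite invfM [_^-1 * _]mulrC mulrCA mulVKf // pnatr_eq0 -lt0n.
Qed.

(** Row sums of the split matrix carry a factor $1/a_i$; dividing by it turns the target 1 into
    $a_i$. *)
Lemma normalize_rows_split m n (A : 'M[R]_(m, n))
    (a : 'I_m -> nat) (b : 'I_n -> nat) : (forall j, 0 < b j)%N ->
  normalize_rows (const_mx 1) (split_mx A a b) =
  split_mx (normalize_rows (natrow a) A) a b.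
Proof.
move=> b0; apply/matrixP => s t.
rewrite [LHS]mxE row_sums_split // !split_mxE [const_mx _ _ _]mxE mul1r.
rewrite [normalize_rows _ _ _ _]mxE [natrow _ _ _]mxE.
by rewrite invf_div mulrACA [A _ _ * _]mulrC [_^-1 * _]mulrC !mulrA.
Qed.

Lemma normalize_cols_split m n (A : 'M[R]_(m, n))
    (a : 'I_m -> nat) (b : 'I_n -> nat) : (forall i, 0 < a i)%N ->
  normalize_cols (const_mx 1) (split_mx A a b) =
  split_mx (normalize_cols (natrow b) A) a b.
Proof.
move=> a0; rewrite !normalize_colsE split_mx_tr normalize_rows_split //.
exact: split_mx_tr.
Qed.

Lemma SK_split m n (B : 'M[R]_(m, n)) (a : 'I_m -> nat) (b : 'I_n -> nat) t :
  (forall i, 0 < a i)%N -> (forall j, 0 < b j)%N ->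
  SK (split_mx B a b) (const_mx 1) (const_mx 1) t =
  split_mx (SK B (natrow a) (natrow b) t) a b.
Proof.
move=> a0 b0; elim: t => [|t IH]; first exact: normalize_rows_split.
rewrite !SKS IH; case: odd; first exact: normalize_rows_split.
exact: normalize_cols_split.
Qed.

(** The $a_i$ equal terms $|r_i/a_i - 1|$ add up to $|r_i - a_i|$. *)
Lemma row_error_split m n (A : 'M[R]_(m, n))
    (a : 'I_m -> nat) (b : 'I_n -> nat) :
  (forall i, 0 < a i)%N -> (forall j, 0 < b j)%N ->
  norm1 (row_sums (split_mx A a b) - const_mx 1) =
  norm1 (row_sums A - natrow a).
Proof.
move=> a0 b0; rewrite /norm1.
under eq_bigr do rewrite mxE row_sums_split // [fun_of_matrix (- _) _ _]mxE
  [const_mx _ _ _]mxE.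
rewrite (sum_sig1 a (fun i => `|row_sums A 0 i / (a i)%:R - 1|)).
apply: eq_bigr => i _; have ai0 : (a i)%:R != 0 :> R by rewrite pnatr_eq0 -lt0n.
rewrite -[X in X * _]normr_nat -normrM mulrBr mulr1 mulrCA divff // mulr1.
by rewrite !mxE.
Qed.

Definition sk_error m n (u : 'rV[R]_m) (v : 'rV[R]_n) (A : 'M[R]_(m, n)) : R :=
  norm1 (row_sums A - u) + norm1 (col_sums A - v).

Lemma sk_error_split m n (A : 'M[R]_(m, n))
    (a : 'I_m -> nat) (b : 'I_n -> nat) :
  (forall i, 0 < a i)%N -> (forall j, 0 < b j)%N ->
  sk_error (const_mx 1) (const_mx 1) (split_mx A a b) =
  sk_error (natrow a) (natrow b) A.
Proof.
by move=> a0 b0; rewrite /sk_error !col_sumsE split_mx_tr !row_error_split.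
Qed.

Lemma sk_errorZ m n (c : R) (u : 'rV_m) (v : 'rV_n) (A : 'M[R]_(m, n)) :
  sk_error (c *: u) (c *: v) (c *: A) = `|c| * sk_error u v A.
Proof.
rewrite /sk_error !col_sumsE [(c *: A)^T]linearZ /= !row_sumsZ.
by rewrite -!scalerBr !norm1Z mulrDr.
Qed.

(** The factor $1/L$ is absorbed by the targets, so both errors to be compared become values of one
    function of the targets. *)
Lemma sk_error_SK_split m n (B : 'M[R]_(m, n))
    (a : 'I_m -> nat) (b : 'I_n -> nat) (L t : nat) : (0 < L)%N ->
  (forall i, 0 < a i)%N -> (forall j, 0 < b j)%N ->
  L%:R^-1 * sk_error (const_mx 1) (const_mx 1)
              (SK (split_mx B a b) (const_mx 1) (const_mx 1) t) =
  sk_error (L%:R^-1 *: natrow a) (L%:R^-1 *: natrow b)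
    (SK B (L%:R^-1 *: natrow a) (L%:R^-1 *: natrow b) t).
Proof.
move=> L0 a0 b0; rewrite SK_split // sk_error_split // SKZ ?sk_errorZ.
  by rewrite ger0_norm // invr_ge0.
by rewrite invr_eq0 pnatr_eq0 -lt0n.
Qed.

(** * Zero pattern of the iterates *)

Lemma normalize_rows_eq0 m n u (A : 'M[R]_(m, n)) i j :
  A i j = 0 -> normalize_rows u A i j = 0.
Proof. by move=> A0; rewrite mxE A0 mulr0 mul0r. Qed.

(** Serves for the approximating targets, which can have zero entries for small $L$;
    [same_pattern_SK] serves for the limit. *)
Lemma SK_eq0 m n (B : 'M[R]_(m, n)) u v t i j :
  B i j = 0 -> SK B u v t i j = 0.
Proof.
move=> B0; elim: t => [|t IH]; first exact: normalize_rows_eq0.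
rewrite SKS normalize_colsE; case: odd; first exact: normalize_rows_eq0.
by rewrite mxE normalize_rows_eq0 // mxE.
Qed.

Lemma row_sums_gt0 m n (A : 'M[R]_(m, n)) i j :
  (forall i j, 0 <= A i j) -> 0 < A i j -> 0 < row_sums A 0 i.
Proof. by move=> A0 Aij; rewrite mxE (bigD1 j) //= ltr_pwDl // sumr_ge0. Qed.

(** [B] acts only as a support. Strict positivity of [A] on it makes every row sum that meets the
    support invertible. *)
Definition same_pattern m n (B A : 'M[R]_(m, n)) :=
  forall i j, (B i j = 0 -> A i j = 0) /\ (B i j <> 0 -> 0 < A i j).

Lemma same_pattern_ge0 m n (B A : 'M[R]_(m, n)) :
  same_pattern B A -> forall i j, 0 <= A i j.
Proof.
move=> BA i j; have [H0 H1] := BA i j.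
by case: (eqVneq (B i j) 0) => [/H0 ->|/eqP /H1 /ltW].
Qed.

Lemma same_pattern_tr m n (B A : 'M[R]_(m, n)) :
  same_pattern B A -> same_pattern B^T A^T.
Proof. by move=> BA i j; rewrite !mxE. Qed.

(** A positive entry lies in a row of positive sum, hence stays positive; a zero stays zero, even in
    a zero row since $0/0=0$. *)
Lemma same_pattern_normalize_rows m n (B A : 'M[R]_(m, n)) (u : 'rV_m) :
  (forall i, 0 < u 0 i) -> same_pattern B A ->
  same_pattern B (normalize_rows u A).
Proof.
move=> u0 BA i j; have [H0 H1] := BA i j; split=> [/H0|/H1 Aij].
  exact: normalize_rows_eq0.
rewrite mxE divr_gt0 ?mulr_gt0 //.
exact: row_sums_gt0 (same_pattern_ge0 BA) Aij.
Qed.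

Lemma same_pattern_SK m n (B : 'M[R]_(m, n)) (u : 'rV_m) (v : 'rV_n) t :
  (forall i j, 0 <= B i j) -> (forall i, 0 < u 0 i) -> (forall j, 0 < v 0 j) ->
  same_pattern B (SK B u v t).
Proof.
move=> B0 u0 v0; elim: t => [|t IH].
  (* [B] has its own pattern, because a nonzero entry of a nonnegative matrix is positive. *)
  apply: same_pattern_normalize_rows => // i j; split=> // /eqP Bij.
  by rewrite lt_def Bij B0.
rewrite SKS normalize_colsE; case: odd.
  exact: same_pattern_normalize_rows.
rewrite -[B]trmxK; apply: same_pattern_tr.
apply: same_pattern_normalize_rows => //.
by rewrite trmxK; apply: same_pattern_tr.
Qed.

(** * Continuity of the iterates and of the error in the targets *)

Section Limits.
Local Open Scope classical_set_scope.
Local Open Scope ring_scope.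

Lemma cvg_sumr k (f : 'I_k -> nat -> R) (a : 'I_k -> R) :
  (forall i, f i L @[L --> \oo] --> a i) ->
  \sum_(i < k) f i L @[L --> \oo] --> \sum_(i < k) a i.
Proof. by move=> fa; apply: cvg_big => //; exact: add_continuous. Qed.

(** Entrywise convergence reduces everything to limits in [R], and covers targets and iterates alike
    since row vectors are matrices. *)
Definition mx_cvg p q (A : nat -> 'M[R]_(p, q)) (A0 : 'M[R]_(p, q)) :=
  forall i j, A L i j @[L --> \oo] --> A0 i j.

Lemma mx_cvg_row_sums p q (A : nat -> 'M[R]_(p, q)) A0 :
  mx_cvg A A0 -> mx_cvg (fun L => row_sums (A L)) (row_sums A0).
Proof.
move=> AA0 i j; rewrite mxE; under eq_fun do rewrite mxE.
by apply: cvg_sumr => k; apply: AA0.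
Qed.

Lemma mx_cvg_tr p q (A : nat -> 'M[R]_(p, q)) A0 :
  mx_cvg A A0 -> mx_cvg (fun L => (A L)^T) A0^T.
Proof.
by move=> AA0 i j; rewrite mxE; under eq_fun do rewrite mxE; apply: AA0.
Qed.

Lemma mx_cvg_col_sums p q (A : nat -> 'M[R]_(p, q)) A0 :
  mx_cvg A A0 -> mx_cvg (fun L => col_sums (A L)) (col_sums A0).
Proof.
move=> AA0; rewrite col_sumsE; under eq_fun do rewrite col_sumsE.
by apply: mx_cvg_row_sums; apply: mx_cvg_tr.
Qed.

Lemma cvg_norm1B k (x y : nat -> 'rV[R]_k) x0 y0 :
  mx_cvg x x0 -> mx_cvg y y0 ->
  norm1 (x L - y L) @[L --> \oo] --> norm1 (x0 - y0).
Proof.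
move=> xx0 yy0; apply: cvg_sumr => i; apply: cvg_norm.
by rewrite !mxE; under eq_fun do rewrite !mxE; apply: cvgB.
Qed.

Lemma cvg_sk_error p q u v (A : nat -> 'M[R]_(p, q)) u0 v0 A0 :
  mx_cvg u u0 -> mx_cvg v v0 -> mx_cvg A A0 ->
  sk_error (u L) (v L) (A L) @[L --> \oo] --> sk_error u0 v0 A0.
Proof.
move=> uu0 vv0 AA0; apply: cvgD; apply: cvg_norm1B => //.
  exact: mx_cvg_row_sums.
exact: mx_cvg_col_sums.
Qed.

(* Both sides vanish identically over a zero of B; over a nonzero entry of B the
   limit row sum is positive, so the quotient is continuous there. *)
Lemma mx_cvg_normalize_rows p q (B : 'M[R]_(p, q)) u
    (A : nat -> 'M[R]_(p, q)) u0 A0 :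
  same_pattern B A0 -> (forall L i j, B i j = 0 -> A L i j = 0) ->
  mx_cvg u u0 -> mx_cvg A A0 ->
  mx_cvg (fun L => normalize_rows (u L) (A L)) (normalize_rows u0 A0).
Proof.
move=> BA0 BA uu0 AA0 i j; have [Bij|/eqP Bij] := eqVneq (B i j) 0.
  rewrite normalize_rows_eq0; last by have [+ _] := BA0 i j; apply.
  under eq_fun do rewrite normalize_rows_eq0 ?BA //.
  exact: cvg_cst.
rewrite [normalize_rows _ _ _ _]mxE; under eq_fun do rewrite mxE.
apply: cvgM; first by apply: cvgM; [exact: uu0 | exact: AA0].
apply: cvgV; last exact: mx_cvg_row_sums.
apply: lt0r_neq0; apply: (@row_sums_gt0 _ _ _ _ j).
  exact: same_pattern_ge0 BA0.
by have [_] := BA0 i j; apply.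
Qed.

Lemma mx_cvg_SK m n (B : 'M[R]_(m, n)) u v (u0 : 'rV_m) (v0 : 'rV_n) t :
  (forall i j, 0 <= B i j) ->
  (forall i, 0 < u0 0 i) -> (forall j, 0 < v0 0 j) ->
  mx_cvg u u0 -> mx_cvg v v0 ->
  mx_cvg (fun L => SK B (u L) (v L) t) (SK B u0 v0 t).
Proof.
move=> B0 u00 v00 uu0 vv0; elim: t => [|t IH].
  apply: (mx_cvg_normalize_rows (B := B)) => // [i j|i j]; last exact: cvg_cst.
  by split=> // /eqP Bij; rewrite lt_def Bij B0.
have BSK := same_pattern_SK t B0 u00 v00.
rewrite SKS normalize_colsE; under eq_fun do rewrite SKS normalize_colsE.
case: odd.
  by apply: (mx_cvg_normalize_rows BSK) => // L i j; apply: SK_eq0.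
apply: mx_cvg_tr.
(* The column step is the row step for the transposes, with the transposed pattern. *)
apply: (mx_cvg_normalize_rows (same_pattern_tr BSK)) => //.
  by move=> L i j; rewrite !mxE; apply: SK_eq0.
exact: mx_cvg_tr.
Qed.

End Limits.

(** * Rounded targets *)

(** Dividing the bound by $L$ gives $|u_i - a_i/L| \le 1/L$, which is at most $e$ once $L \ge
    1/e$. *)
Lemma mx_cvg_rounding k (a : nat -> 'I_k -> nat) (u : 'rV[R]_k) :
  (forall L i, `|L%:R * u 0 i - (a L i)%:R| <= 1) ->
  mx_cvg (fun L => L%:R^-1 *: natrow (a L)) u.
Proof.
move=> au o i; rewrite ord1; under eq_fun do rewrite !mxE.
apply/cvgrPdist_le => e e0; near=> L.
have L0 : 0 < L%:R :> R by near: L; exact: nbhs_infty_gtr.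
rewrite -(ler_pM2l L0) -{1}(gtr0_norm L0) -normrM mulrBr mulVKf ?gt_eqF //.
rewrite (le_trans (au L i)) // -ler_pdivrMr // mul1r.
by near: L; exact: nbhs_infty_ger.
Unshelve. all: by end_near. Qed.

(** The fractional part lies in $[0,1)$, and subtracting 0 or 1 keeps it in $[-1,1]$. The boolean
    [c] is the correction added in [f1] or [f2]. *)
Lemma floor_scale_bound k (u : 'rV[R]_k) L i (c : bool) : 0 < u 0 i ->
  `|L%:R * u 0 i - (floor_scale L u i + c)%:R| <= 1.
Proof.
move=> ui0; have /truncn_itv : 0 <= L%:R * u 0 i by rewrite mulr_ge0 // ltW.
rewrite -/(floor_scale L u i) -natr1 => /andP[lo hi].
rewrite ler_norml natrD opprD addrA.
have : 0 <= (c%:R : R) <= 1 by case: c; rewrite ?lexx ?ler01.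
move=> /andP[c0 c1]; apply/andP; split; lra.
Qed.


Lemma f1_bound m n (u : 'rV[R]_m) (v : 'rV[R]_n) L i : 0 < u 0 i ->
  `|L%:R * u 0 i - (f1 u v L i)%:R| <= 1.
Proof.
move=> ui0; rewrite /f1; case: ifP => _; last exact: floor_scale_bound.
by rewrite -[floor_scale L u i]addn0; apply: (floor_scale_bound L false).
Qed.

Lemma f2_bound m n (u : 'rV[R]_m) (v : 'rV[R]_n) L j : 0 < v 0 j ->
  `|L%:R * v 0 j - (f2 u v L j)%:R| <= 1.
Proof.
move=> vj0; rewrite /f2; case: ifP => _; first exact: floor_scale_bound.
by rewrite -[floor_scale L v j]addn0; apply: (floor_scale_bound L false).
Qed.

Lemma f1_gt0 m n (u : 'rV[R]_m) (v : 'rV[R]_n) L i :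
  (0 < min_floor u v L)%N -> (0 < f1 u v L i)%N.
Proof.
rewrite /min_floor leq_min => /andP[min0 _].
have /(leq_trans min0) floor0 := bigmin_le L i (floor_scale L u).
by rewrite /f1; case: ifP => // _; rewrite ltn_addr.
Qed.

Lemma f2_gt0 m n (u : 'rV[R]_m) (v : 'rV[R]_n) L j :
  (0 < min_floor u v L)%N -> (0 < f2 u v L j)%N.
Proof.
rewrite /min_floor leq_min => /andP[_ min0].
have /(leq_trans min0) floor0 := bigmin_le L j (floor_scale L v).
by rewrite /f2; case: ifP => // _; rewrite ltn_addr.
Qed.

Lemma floor_scale_int k (u : 'rV[R]_k) L i : 0 < u 0 i ->
  L%:R * u 0 i \is a Num.int -> (floor_scale L u i)%:R = L%:R * u 0 i.
Proof.
move=> ui0 uint; apply: truncnK.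
by rewrite natrEint uint mulr_ge0 // ltW.
Qed.

(** The floors are exact, so they add up to $L\|u\|_1 = L$. Applied to both targets, this makes the
    excess vanish. *)
Lemma sum_floor_scale_int k (u : 'rV[R]_k) L : (forall i, 0 < u 0 i) ->
  norm1 u = 1 -> (forall i, L%:R * u 0 i \is a Num.int) ->
  (\sum_(i < k) floor_scale L u i)%N = L.
Proof.
move=> u0 u1 uint; apply/eqP; rewrite -(eqr_nat R) natr_sum.
under eq_bigr do rewrite floor_scale_int //.
rewrite -big_distrr -[X in _ == X]mulr1 -u1; apply/eqP; congr (_ * _).
by apply: eq_bigr => i _; rewrite gtr0_norm.
Qed.

End SinkhornKnopp.

Theorem theorem3p3 (R : realType) (eps : R) (m n : nat)
    (u : 'rV[R]_m) (v : 'rV[R]_n) (B : 'M[R]_(m, n))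
    (eps_gt0 : 0 < eps) (eps_lt1 : eps < 1)
    (m_gt0 : (0 < m)%N) (n_gt0 : (0 < n)%N)
    (u_gt0 : forall i, 0 < u 0 i) (v_gt0 : forall j, 0 < v 0 j)
    (u_norm1 : norm1 u = 1) (v_norm1 : norm1 v = 1)
    (B_ge0 : forall i j, 0 <= B i j) (B_neq0 : B <> 0) :
  (forall t : nat, exists l : nat, forall L : nat,
      (l <= L)%N -> (0 < L)%N -> (2 <= min_floor u v L)%N ->
      let A' := SK B u v t in
      let A := SK (split_mx B (f1 u v L) (f2 u v L))
                  (const_mx 1) (const_mx 1) t in
      `| norm1 (row_sums A' - u) + norm1 (col_sums A' - v)
         - (L%:R)^-1 * (norm1 (row_sums A - const_mx 1)
                        + norm1 (col_sums A - const_mx 1)) | <= eps)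
  /\
  (forall L : nat, (0 < L)%N ->
      (forall i, L%:R * u 0 i \is a Num.int) ->
      (forall j, L%:R * v 0 j \is a Num.int) ->
      forall t : nat,
      let A' := SK B u v t in
      let A := SK (split_mx B (f1 u v L) (f2 u v L))
                  (const_mx 1) (const_mx 1) t in
      norm1 (row_sums A' - u) + norm1 (col_sums A' - v)
      = (L%:R)^-1 * (norm1 (row_sums A - const_mx 1)
                     + norm1 (col_sums A - const_mx 1))).
Proof.
split=> [t|L L_gt0 Lu_int Lv_int t A' A].
  pose uL L := L%:R^-1 *: natrow R (f1 u v L).
  pose vL L := L%:R^-1 *: natrow R (f2 u v L).
  have cvg_u : mx_cvg uL u.
    by apply: mx_cvg_rounding => L i; apply: f1_bound.
  have cvg_v : mx_cvg vL v.
    by apply: mx_cvg_rounding => L j; apply: f2_bound.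
  have cvg_A := mx_cvg_SK (t := t) B_ge0 u_gt0 v_gt0 cvg_u cvg_v.
  (* The threshold [l] comes from the convergence, at this fixed [t], of the error for the rescaled
     rounded targets to the error for [u] and [v]. *)
  have /cvgr_dist_le/(_ _ eps_gt0)[l _ l_eps] :=
    cvg_sk_error cvg_u cvg_v cvg_A.
  exists l => L lL L_gt0 min_gt1; have min_gt0 := ltnW min_gt1.
  cbv zeta; rewrite -/(sk_error u v _) -/(sk_error (const_mx 1) (const_mx 1) _).
  rewrite sk_error_SK_split //; first exact: l_eps.
    by move=> i; apply: f1_gt0.
  by move=> j; apply: f2_gt0.
have L_neq0 : L%:R != 0 :> R by rewrite pnatr_eq0 -lt0n.
(* Both sums of floors equal $L$; without a correction, [f1] and [f2] are exactly $Lu$ and $Lv$. *)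
have excess0 : floor_excess u v L = 0.
  by rewrite /floor_excess !sum_floor_scale_int // subrr.
have f1E i : (f1 u v L i)%:R = L%:R * u 0 i.
  by rewrite /f1 excess0 lexx floor_scale_int.
have f2E j : (f2 u v L j)%:R = L%:R * v 0 j.
  by rewrite /f2 excess0 lexx addn0 floor_scale_int.
have uE : L%:R^-1 *: natrow R (f1 u v L) = u.
  by apply/rowP => i; rewrite !mxE f1E mulKf.
have vE : L%:R^-1 *: natrow R (f2 u v L) = v.
  by apply/rowP => j; rewrite !mxE f2E mulKf.
rewrite -/(sk_error u v A') -/(sk_error (const_mx 1) (const_mx 1) A).
rewrite sk_error_SK_split ?uE ?vE // => [i|j].
  (* Here the block sizes are positive because they equal $Lu_i$ and $Lv_j$. *)
  by rewrite -(ltr_nat R) f1E mulr_gt0 // ltr0n.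
by rewrite -(ltr_nat R) f2E mulr_gt0 // ltr0n.
Qed.
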